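(* Let $S\in\mathbb{R}^{\nu\times\nu}$, $L\in\mathbb{R}^{1\times\nu}$ with $(L,S)$ observable and $\sigma(S)\cap\Omega=\emptyset$, and let $\Pi\in\mathbb{R}^{n\times\nu}$ be the unique solution of $M\Pi S^2+D\Pi S+K\Pi=BL$. Let $m\le\nu$, let $Q_p\in\mathbb{R}^{m\times m}$ with $\sigma(Q_p)=\{\lambda_1,\dots,\lambda_m\}$, $\sigma(Q_p)\cap\Omega=\emptyset$ and $\sigma(Q_p)\cap\sigma(S)=\emptyset$, let $R_p\in\mathbb{R}^{m}$ be such that $(Q_p,R_p)$ is controllable, and let $C_{p0},C_{p1}\in\mathbb{R}^{1\times n}$ satisfy $C_{p0}\Pi=C_{p1}\Pi=0$. Let $\Upsilon_p\in\mathbb{R}^{m\times n}$ be the unique solution of $$Q_p^2\Upsilon_pM+Q_p\Upsilon_pD+\Upsilon_pK=R_pC_{p0}+Q_pR_pC_{p1},$$ and assume $\operatorname{rank}(\Upsilon_p\Pi)=m$. Consider the family $\widehat\Sigma_G$ of reduced models, parameterized by $F_1,F_2,G,H_1$, matching the moments of $\Sigma$ at $\sigma(S)$. If $$\Upsilon_p\Pi F_2=\Upsilon_pM\Pi,\qquad \Upsilon_p\Pi F_1=\Upsilon_pD\Pi,\qquad \Upsilon_p\Pi G=\Upsilon_pB,$$ then $\sigma(Q_p)=\{\lambda_1,\dots,\lambda_m\}\subseteq\widehat\Omega$, where $\widehat\Omega$ is the set of poles of $\widehat\Sigma_G$.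
   Context: $\Sigma$ is the single-input single-output second-order system $M\ddot x+D\dot x+Kx=Bu$, $y=C_1\dot x+C_0x$, with $M,D,K\in\mathbb{R}^{n\times n}$, $B\in\mathbb{R}^{n}$, $C_0,C_1\in\mathbb{R}^{1\times n}$; $\Omega=\{s\in\mathbb{C}:\det(Ms^2+Ds+K)=0\}$ is assumed to consist of $2n$ points counted with multiplicity; $\nu<n$. The family $\widehat\Sigma_G$ consists of the models $F_2\ddot\xi+F_1\dot\xi+F_0\xi=Gu$, $\psi=H_1\dot\xi+H_0\xi$, with free parameters $F_1,F_2\in\mathbb{R}^{\nu\times\nu}$, $G\in\mathbb{R}^{\nu}$, $H_1\in\mathbb{R}^{1\times\nu}$ and with $F_0=GL-F_2S^2-F_1S$, $H_0=C_0\Pi+C_1\Pi S-H_1S$. Its pole set is $\widehat\Omega=\{s\in\mathbb{C}:\det(s^2F_2+sF_1+F_0)=0\}$, assumed to consist of $2\nu$ points counted with multiplicity. *)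

(* Defs.v *)
From HB Require Import structures.
From mathcomp Require Import all_boot all_order all_algebra.
From mathcomp Require Import all_classical all_reals.
From mathcomp Require Import complex.

Set Implicit Arguments.
Unset Strict Implicit.
Unset Printing Implicit Defensive.

Import Order.TTheory GRing.Theory Num.Theory.
Local Open Scope classical_set_scope.
Local Open Scope ring_scope.

Section SecondOrder.
Context {R : realType}.

Definition complex_mx m n (A : 'M[R]_(m, n)) : 'M[R[i]]_(m, n) :=
  map_mx (real_complex R) A.

Definition spectrum n (A : 'M[R]_n) : set R[i] :=
  [set s | eigenvalue (complex_mx A) s].

(* Kalman rank conditions.  The rows of the first matrix are
   L, L S, ..., L S^(n-1); the columns of the second are
   G, Q G, ..., Q^(n-1) G. *)
Definition observable n (L : 'rV[R]_n) (S : 'M[R]_n) : Prop :=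
  \rank (\matrix_(i < n) (L *m S ^+ i)) = n.

Definition controllable n (Q : 'M[R]_n) (G : 'cV[R]_n) : Prop :=
  \rank (\matrix_(i < n, j < n) (Q ^+ j *m G) i 0) = n.

(* M x'' + D x' + K x = B u,  y = C1 x' + C0 x. *)
Record so_system (n : nat) := SOSystem {
  so_M : 'M[R]_n;
  so_D : 'M[R]_n;
  so_K : 'M[R]_n;
  so_B : 'cV[R]_n;
  so_C1 : 'rV[R]_n;
  so_C0 : 'rV[R]_n
}.

Definition poles n (Sys : so_system n) : set R[i] :=
  [set s | \det (s ^+ 2 *: complex_mx (so_M Sys) + s *: complex_mx (so_D Sys)
                 + complex_mx (so_K Sys)) = 0].

(* det (M X^2 + D X + K) as a polynomial, needed to speak of the
   multiplicities of the poles. *)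
Definition pole_poly n (Sys : so_system n) : {poly R[i]} :=
  \det ('X^2 *: map_mx polyC (complex_mx (so_M Sys))
        + 'X *: map_mx polyC (complex_mx (so_D Sys))
        + map_mx polyC (complex_mx (so_K Sys))).

Lemma polesE n (Sys : so_system n) :
  poles Sys = [set s | root (pole_poly Sys) s].
Proof.
suff e s : (pole_poly Sys).[s] =
    \det (s ^+ 2 *: complex_mx (so_M Sys) + s *: complex_mx (so_D Sys)
                 + complex_mx (so_K Sys)).
  by apply/seteqP; split=> s /=; rewrite /root e => /eqP.
rewrite /pole_poly -[LHS]/(horner_eval s _) -det_map_mx; congr (\det _).
by apply/matrixP=> i j; rewrite !mxE /= /horner_eval !hornerE.
Qed.

(* The pole set consists of k points counted with multiplicity.  As %= is
   equality up to a nonzero constant, this excludes pole_poly Sys = 0. *)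
Definition pole_count n (Sys : so_system n) (k : nat) : Prop :=
  exists rs : k.-tuple R[i], pole_poly Sys %= \prod_(z <- rs) ('X - z%:P).

(* The family of reduced models
   F2 xi'' + F1 xi' + F0 xi = G u,  psi = H1 xi' + H0 xi
   with F0 and H0 determined by the free parameters F1, F2, G, H1. *)
Definition reduced_model n nu (Sys : so_system n)
    (S : 'M[R]_nu) (L : 'rV[R]_nu) (Pi : 'M[R]_(n, nu))
    (F1 F2 : 'M[R]_nu) (G : 'cV[R]_nu) (H1 : 'rV[R]_nu) : so_system nu :=
  {| so_M := F2;
     so_D := F1;
     so_K := G *m L - F2 *m S ^+ 2 - F1 *m S;
     so_B := G;
     so_C1 := H1;
     so_C0 := so_C0 Sys *m Pi + so_C1 Sys *m Pi *m S - H1 *m S |}.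

End SecondOrder.

Arguments so_system R n : clear implicits.

(* Main.v *)
(* With P = Upsp Pi, the constraints and the two Sylvester equations give
   Qp^2 P F2 + Qp P F1 + P F0 = 0.  If v is a left eigenvector of Qp for s,
   then v P annihilates s^2 F2 + s F1 + F0 from the left, and v P is nonzero
   because P has full row rank. *)

Require Import Defs.
From HB Require Import structures.
From mathcomp Require Import all_boot all_order all_algebra.
From mathcomp Require Import all_classical all_reals.
From mathcomp Require Import complex.

Set Implicit Arguments.
Unset Strict Implicit.
Unset Printing Implicit Defensive.

Import Order.TTheory GRing.Theory Num.Theory.
Local Open Scope classical_set_scope.
Local Open Scope ring_scope.

(** Kept over an arbitrary field so that it applies after complexification, where the real matrix
    [Qp] has its eigenvalues. *)
Lemma det_quadratic_pencil_eq0 (F : fieldType) (m nu : nat) (Q : 'M[F]_m)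
    (P : 'M[F]_(m, nu)) (F2 F1 F0 : 'M[F]_nu) (s : F) :
  row_free P ->
  Q ^+ 2 *m P *m F2 + Q *m P *m F1 + P *m F0 = 0 ->
  eigenvalue Q s ->
  \det (s ^+ 2 *: F2 + s *: F1 + F0) = 0.
Proof.
move=> freeP eqP0 /eigenvalueP[v vQ v_neq0].
apply/eqP/det0P; exists (v *m P).
  apply: contra v_neq0 => /eqP vP0.
  by apply/eqP/(row_free_inj freeP); rewrite vP0 mul0mx.
(* Multiply the hypothesis by [v] on the left; each factor [Q] next to [v] becomes the scalar
   [s]. *)
rewrite -[RHS](mulmx0 _ v) -[in RHS]eqP0 !mulmxDr [Q ^+ 2]expr2 -mulmxE !mulmxA vQ.
by rewrite -!scalemxAl vQ -!scalemxAl -!scalemxAr scalerA -expr2.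
Qed.

Theorem theorem3 (R : realType) (n nu m : nat)
    (M D K : 'M[R]_n) (B : 'cV[R]_n) (C1 C0 : 'rV[R]_n)
    (Sigma := SOSystem M D K B C1 C0)
    (S : 'M[R]_nu) (L : 'rV[R]_nu) (Pi : 'M[R]_(n, nu))
    (Qp : 'M[R]_m) (lambda : 'I_m -> R[i]) (Rp : 'cV[R]_m)
    (Cp0 Cp1 : 'rV[R]_n) (Upsp : 'M[R]_(m, n))
    (F1 F2 : 'M[R]_nu) (G : 'cV[R]_nu) (H1 : 'rV[R]_nu)
    (SigmaG := reduced_model Sigma S L Pi F1 F2 G H1) :
  (nu < n)%N ->
  pole_count Sigma (2 * n) ->
  observable L S ->
  spectrum S `&` poles Sigma = set0 ->
  M *m Pi *m S ^+ 2 + D *m Pi *m S + K *m Pi = B *m L ->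
  (m <= nu)%N ->
  spectrum Qp = range lambda ->
  spectrum Qp `&` poles Sigma = set0 ->
  spectrum Qp `&` spectrum S = set0 ->
  controllable Qp Rp ->
  Cp0 *m Pi = 0 ->
  Cp1 *m Pi = 0 ->
  Qp ^+ 2 *m Upsp *m M + Qp *m Upsp *m D + Upsp *m K
    = Rp *m Cp0 + Qp *m Rp *m Cp1 ->
  \rank (Upsp *m Pi) = m ->
  pole_count SigmaG (2 * nu) ->
  Upsp *m Pi *m F2 = Upsp *m M *m Pi ->
  Upsp *m Pi *m F1 = Upsp *m D *m Pi ->
  Upsp *m Pi *m G = Upsp *m B ->
  spectrum Qp `<=` poles SigmaG.
Proof.
move=> _ _ _ _ eqPi _ _ _ _ _ Cp0Pi Cp1Pi eqUps rankP _ eqF2 eqF1 eqG s Qs.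
set F0 := G *m L - F2 *m S ^+ 2 - F1 *m S.
(* The constraint on [G] yields [Upsp *m B *m L]; expanding [B *m L] by the equation for [Pi], the
   terms in [M] and [D] cancel. *)
have eqF0 : Upsp *m Pi *m F0 = Upsp *m K *m Pi.
  rewrite /F0 !mulmxBr !mulmxA eqG eqF2 eqF1 -!(mulmxA Upsp) -eqPi !mulmxDr.
  by rewrite !mulmxA -addrA -opprD addrAC subrr add0r.
have eqP0 : Qp ^+ 2 *m (Upsp *m Pi) *m F2 + Qp *m (Upsp *m Pi) *m F1
    + Upsp *m Pi *m F0 = 0.
  (* With [Pi] factored out on the right, the equation for [Upsp] leaves only terms in [Cp0 *m Pi]
     and [Cp1 *m Pi]. *)
  rewrite -2!(mulmxA _ (Upsp *m Pi)) eqF2 eqF1 eqF0 !mulmxA -!mulmxDl eqUps.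
  by rewrite mulmxDl -!mulmxA Cp0Pi Cp1Pi !mulmx0 addr0.
apply: (@det_quadratic_pencil_eq0 _ _ _ (complex_mx Qp)
  (complex_mx (Upsp *m Pi))) Qs.
  (* Rank is unchanged by the field extension from reals to complexes. *)
  by rewrite /row_free mxrank_map rankP.
rewrite /complex_mx [_ ^+ 2]expr2 -mulmxE -!map_mxM -!map_mxD.
by rewrite [X in map_mx _ X](_ : _ = 0) ?map_mx0 // -[RHS]eqP0.
Qed.
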